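(* Let $R=k[x_0,\ldots,x_N]$, where $k$ is any field, and let $I$ be a nonzero homogeneous ideal in $R$. Then there exists an integer $t_0>0$ such that for all $t\geq t_0$ one has $$\frac{\alpha\big((I^{(t)})^{(m)}\big)}{m}\geq \frac{\alpha(I^{(t)})+N-1}{N}\quad\text{for every } m\geq 1.$$
   Context: $R=k[x_0,\ldots,x_N]$ is the homogeneous coordinate ring of $\mathbb{P}_k^N$. For a nonzero homogeneous ideal $J$ of $R$, the initial degree $\alpha(J)$ is the least degree of a nonzero polynomial in $J$. For a homogeneous ideal $J$ of $R$ and an integer $m\geq 1$, the $m$-th symbolic power of $J$ is $J^{(m)}=\bigcap_{p\in\mathrm{Ass}(R/J)}(J^mR_p\cap R)$, where the intersection runs over all associated primes of $R/J$, including embedded ones.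
   Formalization: The ideal I is taken to be proper, since for I = R all symbolic powers are R, the initial degree is 0, and the inequality fails when N ≥ 2; also N ≥ 1 is assumed so that the division by N makes sense. *)

(* Defs.v *)
From mathcomp Require Import all_boot all_order all_algebra.
From mathcomp Require Import boolp classical_sets.
From mathcomp Require Import mpoly.

Set Implicit Arguments.
Unset Strict Implicit.
Unset Printing Implicit Defensive.

Import Order.TTheory GRing.Theory Num.Theory.
Local Open Scope ring_scope.
Local Open Scope classical_set_scope.

(* MathComp's [idealr_closed] requires [1 \notin J], so ideals, and prime
   ideals in particular, are proper. *)
Definition prime_ideal (R : nzRingType) (p : set R) : Prop :=
  idealr_closed [pred x in p] /\ prime_idealr_closed [pred x in p].

(* Finite sums of products: the product ideal if [A] and [B] are ideals, and
   the ideal of the ring [A] generated by [B] if [A] is a subring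
   containing [B]. *)
Definition sum_of_products (R : nzRingType) (A B : set R) : set R :=
  [set f | exists (n : nat) (a b : 'I_n -> R),
     [/\ forall i, A (a i), forall i, B (b i) & f = \sum_(i < n) a i * b i]].

Definition ideal_exp (R : nzRingType) (J : set R) (m : nat) : set R :=
  iter m (sum_of_products J) setT.

(* Associated primes of [R/J]: the primes that are the annihilator of the
   class in [R/J] of some [f] in [R]; [r] kills that class iff [r * f] is in
   [J]. *)
Definition Ass (R : nzRingType) (J : set R) : set (set R) :=
  [set p | prime_ideal p /\ exists f, p = [set r | J (r * f)]].

(* For a domain [R], the localization at [p] is a subring of the fraction
   field. *)
Definition local_ring (R : idomainType) (p : set R) : set {fraction R} :=
  [set x | exists a s : R, ~ p s /\ x = tofrac a / tofrac s].

(* J R_p *)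
Definition local_extension (R : idomainType) (p J : set R) :
    set {fraction R} :=
  sum_of_products (local_ring p) (@tofrac R @` J).

(* J^(m): embedded associated primes are included; [J^m R_p] is contracted to
   [R] along [tofrac]. *)
Definition symbolic_power (R : idomainType) (J : set R) (m : nat) : set R :=
  \bigcap_(p in Ass J) [set f | local_extension p (ideal_exp J m) (tofrac f)].

Definition homogeneous (k : fieldType) (n : nat) (J : set {mpoly k[n]}) : Prop :=
  forall f, J f -> forall d : nat, J (pihomog mdeg d f).

(* [msize f] is one more than the total degree of [f], for [f != 0]. *)
Definition degrees (k : fieldType) (n : nat) (J : set {mpoly k[n]}) : set nat :=
  [set d | exists2 f, J f & f != 0 /\ (msize f).-1 = d].

(* The least element of [degrees J]; it is 0 by convention if [J] has no
   nonzero element. *)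
Definition initial_degree (k : fieldType) (n : nat) (J : set {mpoly k[n]}) : nat :=
  xget 0%N [set d | degrees J d /\ forall e, degrees J e -> (d <= e)%N].

(* Main.v *)
(** If [J = I^(t)] and [p] is associated to [J], then [p] is contained in a prime
associated to [I], so [J] and [I^t] agree at [p]. Hence [J^(m)] lies in the
contraction [I_S^(tm)] of [I^(tm)] from the localizations at the primes of
[S = Ass J], while [J = I_S^(t)]. For fixed [S] the function
[n |-> alpha(I_S^(n))] is subadditive, and Taylor expansion modulo [p] shows that
it is at least [n]; so [alpha(I_S^(n)) / n] has a positive limit, its infimum, which
gives the bound for large [t] if [N >= 2]. By Brodmann's argument on the associated
graded ring only finitely many [S] occur, so [t0] does not depend on [S].

If [N = 1], then [alpha(J^(m)) = m alpha(J)] for homogeneous [J]: if the irrelevant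
ideal is associated to [J], then [J^(m) = J^m], and otherwise [J] is principal. *)
Require Import Defs.
From mathcomp Require Import all_boot all_order all_algebra.
From mathcomp Require Import boolp classical_sets.
From mathcomp Require Import mpoly.
From mathcomp Require Import zify ring.
Import Order.TTheory GRing.Theory Num.Theory.
Local Open Scope ring_scope.
Local Open Scope classical_set_scope.

Set Implicit Arguments.
Unset Strict Implicit.
Unset Printing Implicit Defensive.

(** The primes of [Ass J] lie below those of [Ass I] but need not include them, so [J^(m)] is not
    compared with [I^(tm)]. This forces the family [I_S^(n)] with [S = Ass J], a set that varies
    with [t], and with it the need for finitely many [S].

    For [N >= 2] the room comes from the factor [N]: if [c] is the limit of [alpha(I_S^(n)) / n],
    then [alpha(I_S^(t))] is about [c t], whereas [N alpha(I_S^(tm)) / m] is at least [N c t]; the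
    gap absorbs [N - 1] once [t] is large. No limit is formed: an index [s] whose ratio is at most
    3/2 times every other ratio is enough, because [2 N / 3 > 1].

    For [N = 1] there is no room, and [alpha(J^(m)) >= m alpha(J)] has to hold exactly. *)

(** * Noetherian rings *)

(* Unlike [idealr_closed], this allows the unit ideal. *)
Definition ideal (A : comNzRingType) (J : set A) : Prop :=
  [/\ J 0, forall x y, J x -> J y -> J (x + y) & forall a x, J x -> J (a * x)].

Section Ideals.
Variable A : comNzRingType.
Implicit Types (J K : set A) (s : seq A).

Lemma ideal_0 J : ideal J -> J 0. Proof. by case. Qed.
Lemma ideal_add J : ideal J -> forall x y, J x -> J y -> J (x + y).
Proof. by case. Qed.
Lemma ideal_mull J : ideal J -> forall a x, J x -> J (a * x).
Proof. by case. Qed.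
Lemma ideal_mulr J : ideal J -> forall a x, J x -> J (x * a).
Proof. by move=> iJ a x Jx; rewrite mulrC; apply: ideal_mull. Qed.
Lemma ideal_opp J : ideal J -> forall x, J x -> J (- x).
Proof. by move=> iJ x Jx; rewrite -mulN1r; apply: ideal_mull. Qed.
Lemma ideal_sub J : ideal J -> forall x y, J x -> J y -> J (x - y).
Proof. by move=> iJ x y Jx Jy; apply: ideal_add => //; apply: ideal_opp. Qed.
Lemma ideal_sum J (I : Type) (r : seq I) (P : pred I) (F : I -> A) :
  ideal J -> (forall i, P i -> J (F i)) -> J (\sum_(i <- r | P i) F i).
Proof. by move=> iJ JF; apply: big_ind => //; [exact: ideal_0|exact: ideal_add]. Qed.

Definition adjoin (a : A) J : set A := [set x | exists c y, J y /\ x = c * a + y].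

Lemma adjoin_ideal a J : ideal J -> ideal (adjoin a J).
Proof.
move=> iJ; split.
- by exists 0, 0; split; [exact: ideal_0|rewrite mul0r addr0].
- move=> _ _ [c [y [Jy ->]]] [c' [y' [Jy' ->]]].
  by exists (c + c'), (y + y'); split; [exact: ideal_add|rewrite mulrDl addrACA].
- move=> b _ [c [y [Jy ->]]].
  by exists (b * c), (b * y); split; [exact: ideal_mull|rewrite mulrDr mulrA].
Qed.

Lemma adjoin_gen a J : ideal J -> adjoin a J a.
Proof. by move=> iJ; exists 1, 0; split; [exact: ideal_0|rewrite mul1r addr0]. Qed.

Lemma sub_adjoin a J : J `<=` adjoin a J.
Proof. by move=> x Jx; exists 0, x; rewrite mul0r add0r. Qed.

Definition gen s : set A := foldr adjoin [set 0] s.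

Lemma gen_ideal s : ideal (gen s).
Proof.
elim: s => [|a s IH]; last exact: adjoin_ideal.
by split=> [|x y -> ->|a x ->] //=; rewrite ?addr0 ?mulr0.
Qed.

Lemma gen_mem s a : a \in s -> gen s a.
Proof.
elim: s => [//|b s IH]; rewrite inE => /predU1P[->|/IH sa].
  by apply: adjoin_gen; exact: gen_ideal.
exact: sub_adjoin.
Qed.

Lemma gen_min s J : ideal J -> (forall a, a \in s -> J a) -> gen s `<=` J.
Proof.
move=> iJ; elim: s => [_ x -> |a s IH sJ x]; first exact: ideal_0.
move=> [c [y [sy ->]]]; apply: ideal_add => //.
  by apply: ideal_mull => //; apply: sJ; rewrite mem_head.
by apply: IH sy => b bs; apply: sJ; rewrite inE bs orbT.
Qed.

Lemma gen_sub s t : {subset s <= t} -> gen s `<=` gen t.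
Proof.
move=> st; apply: gen_min; first exact: gen_ideal.
by move=> a /st; apply: gen_mem.
Qed.

Lemma colon_ideal J f : ideal J -> ideal [set r | J (r * f)].
Proof.
move=> iJ; split=> /= [|x y Jx Jy|a x Jx].
- by rewrite mul0r; apply: ideal_0.
- by rewrite mulrDl; apply: ideal_add.
- by rewrite -mulrA; apply: ideal_mull.
Qed.

End Ideals.

(** The ascending chain condition, stated for sequences of elements instead of chains of ideals. *)
Definition noetherian (A : comNzRingType) : Prop :=
  forall u : nat -> A, exists n, gen (mkseq u n) (u n).

Lemma noetherian_field (k : fieldType) : noetherian k.
Proof.
move=> u; have [u0|u0] := eqVneq (u 0%N) 0; first by exists 0%N.
exists 1%N => /=; exists (u 1%N / u 0%N), 0; split => //.
by rewrite addr0 divfK.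
Qed.

Section NoetherianInduction.
Variable A : comNzRingType.
Hypothesis nA : noetherian A.

(** Otherwise ever larger counterexamples form a strictly ascending chain, and elements [u n] of its
    successive differences contradict [noetherian]. *)
Lemma noetherian_ind (P : set A -> Prop) :
    (forall J, ideal J ->
       (forall K, ideal K -> J `<=` K -> ~ (K `<=` J) -> P K) -> P J) ->
  forall J, ideal J -> P J.
Proof.
move=> HP J0 iJ0; apply: contrapT => nPJ0.
(* The hypothesis stands inside the existential so that [choice] yields a total function; its values
   elsewhere do not matter. *)
have step J : exists K, ideal J /\ ~ P J ->
    [/\ ideal K, ~ P K, J `<=` K & ~ (K `<=` J)].
  have [[iJ nPJ]|nJ] := pselect (ideal J /\ ~ P J); last by exists J => /nJ.
  apply: contrapT => nex; apply: nPJ; apply: HP => // K iK JK nKJ.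
  by apply: contrapT => nPK; apply: nex; exists K.
have [f Hf] := choice step.
pose C n := iter n f J0.
have bad n : ideal (C n) /\ ~ P (C n).
  by elim: n => [//|n /Hf[]].
have [u Hu] : exists u : nat -> A, forall n, C n.+1 (u n) /\ ~ C n (u n).
  suff /choice[u Hu] : forall n, exists x, C n.+1 x /\ ~ C n x by exists u.
  move=> n; have [_ _ _ nC] := Hf _ (bad n).
  by apply: contrapT => nex; apply: nC => x Cx; apply: contrapT => nx; apply: nex; exists x.
have mono m n : (m <= n)%N -> C m `<=` C n.
  move=> /subnK <-; elim: (n - m)%N => [//|d IH] x /IH.
  by have [_ _ + _] := Hf _ (bad (d + m)%N); apply.
have [n] := nA u; apply: (contra_not _ (Hu n).2).
apply: gen_min; first exact: (bad n).1.
by move=> a /mapP[i]; rewrite mem_iota /= add0n => lin ->; apply: mono lin _ (Hu i).1.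
Qed.

(** The induction is on the ideal generated by a list of elements of [J]: while it misses an element
    of [J], adding that element enlarges it. *)
Lemma noetherian_fg (J : set A) : ideal J ->
  exists s, (forall a, a \in s -> J a) /\ J `<=` gen s.
Proof.
move=> iJ.
suff H K : ideal K -> forall s, (forall a, a \in s -> J a) -> K = gen s ->
    exists s, (forall a, a \in s -> J a) /\ J `<=` gen s.
  by apply: (H (gen [::]) (gen_ideal _) [::]).
move: K; apply: noetherian_ind => K iK IH s sJ Ks.
have [sub|/existsNP[x /not_implyP[Jx nsx]]] := pselect (J `<=` gen s); first by exists s.
apply: (IH (gen (x :: s)) (gen_ideal _) _ _ (x :: s)) => //.
- by rewrite Ks; exact: sub_adjoin.
- by rewrite Ks; move=> sub; apply: nsx; apply: sub; apply: gen_mem; rewrite mem_head.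
- by move=> a; rewrite inE => /predU1P[->|/sJ].
Qed.

End NoetherianInduction.

Lemma noetherian_surj (A B : comNzRingType) (f : {rmorphism A -> B}) :
  (forall b, exists a, f a = b) -> noetherian A -> noetherian B.
Proof.
move=> fsurj nA u; have [v Hv] := choice (fun n => fsurj (u n)).
have [n Hn] := nA v; exists n; rewrite -Hv.
suff /(_ _ Hn) : gen (mkseq v n) `<=` [set a | gen (mkseq u n) (f a)] by [].
apply: gen_min.
  have iu := gen_ideal (mkseq u n); split=> /= [|x y ux uy|a x ux].
  - by rewrite rmorph0; apply: ideal_0.
  - by rewrite rmorphD; apply: ideal_add.
  - by rewrite rmorphM; apply: ideal_mull.
by move=> a /mapP[i i_n ->] /=; rewrite Hv; apply/gen_mem/map_f.
Qed.

(* Sarges: choose [f n] of minimal degree outside the ideal generated by its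
   predecessors; a relation between the leading coefficients lowers that degree. *)
Lemma noetherian_poly (A : comNzRingType) : noetherian A -> noetherian {poly A}.
Proof.
move=> nA u; apply: contrapT => /forallNP bad.
pose J := [set x | exists n, gen (mkseq u n) x].
have umono m n : (m <= n)%N -> gen (mkseq u m) `<=` gen (mkseq u n).
  move=> mn; apply: gen_sub => x /mapP[i]; rewrite mem_iota /= add0n => im ->.
  by apply: map_f; rewrite mem_iota /= add0n (leq_trans im).
have iJ : ideal J.
  split=> [|x y [m Hm] [n Hn]|a x [n Hn]].
  - by exists 0%N.
  - exists (maxn m n); apply: ideal_add; first exact: gen_ideal.
      by apply: umono Hm; rewrite leq_maxl.
    by apply: umono Hn; rewrite leq_maxr.
  - by exists n; apply: ideal_mull => //; exact: gen_ideal.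
have step s : exists x, (forall a, a \in s -> J a) ->
    [/\ J x, ~ gen s x & forall y, J y -> ~ gen s y -> (size x <= size y)%N].
  have [sJ|nsJ] := pselect (forall a, a \in s -> J a); last by exists 0 => /nsJ.
  pose Q n := `[< exists x, [/\ J x, ~ gen s x & size x = n] >].
  (* [gen s] lies in a single stage of the chain, so the corresponding [u n] belongs to [J] but not
     to [gen s]. *)
  have [n Hn] : exists n, gen s `<=` gen (mkseq u n).
    elim: s sJ {Q} => [_|a s IH sJ]; first by exists 0%N.
    have [n Hn] : exists n, gen s `<=` gen (mkseq u n).
      by apply: IH => b bs; apply: sJ; rewrite inE bs orbT.
    have [m Hm] := sJ a (mem_head _ _).
    exists (maxn m n); apply: gen_min; first exact: gen_ideal.
    move=> b; rewrite inE => /predU1P[->|/gen_mem/Hn].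
      by apply: umono Hm; rewrite leq_maxl.
    by apply: umono; rewrite leq_maxr.
  have exQ : exists n, Q n.
    exists (size (u n)); apply/asboolP; exists (u n); split => //; last by move/Hn/bad.
    by exists n.+1; apply: gen_mem; apply: map_f; rewrite mem_iota /= add0n.
  case: (ex_minnP exQ) => d /asboolP[x [Jx nx <-]] dmin.
  exists x => _; split => // y Jy ny; apply: dmin; apply/asboolP; by exists y.
have {step}[g Hg] := choice step.
(* Course-of-values recursion: [L n] lists the earlier choices [f i], [i < n], on which the choice
   of [f n] depends. *)
pose L := fix L n := if n is n'.+1 then g (L n') :: L n' else [::].
pose f n := g (L n).
have LJ n a : a \in L n -> J a.
  elim: n a => [//|n IH] a; rewrite inE => /predU1P[->|]; last exact: IH.
  by have [] := Hg _ IH.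
have [fJ nf fmin] : [/\ forall n, J (f n), forall n, ~ gen (L n) (f n) &
    forall n y, J y -> ~ gen (L n) y -> (size (f n) <= size y)%N].
  by split=> n; have [] := Hg _ (LJ n).
have fL i n : (i < n)%N -> f i \in L n.
  elim: n => [//|n IH]; rewrite ltnS leq_eqVlt inE => /predU1P[->|/IH ->].
    by rewrite eqxx.
  by rewrite orbT.
have Lmono i n : (i <= n)%N -> {subset L i <= L n}.
  move=> /subnK <-; elim: (n - i)%N => [//|d IH] x /IH.
  by rewrite addSn inE => ->; rewrite orbT.
have fneq0 n : f n != 0.
  by apply/eqP => f0; apply: (nf n); rewrite f0; exact: (ideal_0 (gen_ideal _)).
have [n Hn] := nA (fun i => lead_coef (f i)).
pose d := (size (f n)).-1.
have sfn : size (f n) = d.+1 by rewrite /d prednK // size_poly_gt0.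
(* The coefficients of degree [d] of elements of [gen (L n)] of degree at most [d] form an ideal. It
   contains the leading coefficients of the earlier [f i], shifted by powers of ['X], hence also
   that of [f n]. *)
suff /(_ _ Hn) : gen (mkseq (fun i => lead_coef (f i)) n) `<=`
    [set c | exists F, [/\ gen (L n) F, (size F <= d.+1)%N & F`_d = c]].
  move=> [F [spF sF Fd]].
  have : (size (f n) <= size (f n - F)%R)%N.
    apply: fmin.
      apply: ideal_sub => //; apply: gen_min spF => //; exact: LJ.
    move=> H; apply: (nf n); rewrite -(subrK F (f n)).
    by apply: ideal_add => //; exact: gen_ideal.
  apply/negP; rewrite -ltnNge sfn ltnS; apply/leq_sizeP => j.
  rewrite leq_eqVlt coefB => /predU1P[<-|dj].
    by rewrite Fd lead_coefE sfn subrr.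
  by rewrite !nth_default ?subrr // ?sfn // (leq_trans sF).
have iL := gen_ideal (L n).
apply: gen_min.
  split=> [|_ _ [F [spF sF <-]] [G [spG sG <-]]|c _ [F [spF sF <-]]].
  - by exists 0; rewrite size_poly0 coef0; split => //; exact: ideal_0.
  - exists (F + G); rewrite coefD; split => //; first exact: ideal_add.
    by rewrite (leq_trans (size_polyD _ _)) // geq_max sF.
  - exists (c%:P * F); rewrite coefCM; split => //; first exact: ideal_mull.
    by rewrite mul_polyC (leq_trans (size_scale_leq _ _)).
move=> a /mapP[i]; rewrite mem_iota /= add0n => lin ->.
have sfi : (size (f i) <= d.+1)%N.
  rewrite -sfn; apply: fmin => //; apply: contra_not (nf n).
  by apply: gen_sub; apply: Lmono; apply: ltnW.
exists (f i * 'X^(d - (size (f i)).-1)); split.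
- by apply: ideal_mulr => //; apply/gen_mem/fL.
- rewrite size_Mmonic ?monicXn // size_polyXn.
  by rewrite -(prednK (_ : 0 < size (f i))%N) ?size_poly_gt0 //= in sfi *; lia.
- rewrite coefMXn ltnNge leq_subr /= subKn ?lead_coefE //.
  by rewrite -ltnS prednK ?size_poly_gt0.
Qed.

Lemma mpoly_rmorph_surj (B : comNzRingType) (A : comNzRingType) n
    (f : {rmorphism B -> {mpoly A[n]}}) :
    (forall c, exists b, f b = c%:MP) -> (forall i, exists b, f b = 'X_i) ->
  forall p, exists b, f b = p.
Proof.
move=> fC fX; have [g Hg] := choice fX; have [h Hh] := choice fC.
move=> p; exists (\sum_(m <- msupp p) h p@_m * \prod_i g i ^+ m i).
rewrite rmorph_sum [RHS]mpolyE; apply: eq_bigr => m _.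
rewrite rmorphM Hh mul_mpolyC rmorph_prod mpolyXE_id; congr (_ *: _).
by apply: eq_bigr => i _; rewrite rmorphXn Hg.
Qed.

(** Noetherianity passes to images, so the induction step only needs a surjection from [{poly {mpoly
    A[n]}}], sending ['X] to the last variable. *)
Lemma noetherian_mpoly (A : comNzRingType) n : noetherian A -> noetherian {mpoly A[n]}.
Proof.
move=> nA; elim: n => [|n /noetherian_poly].
  pose f : {rmorphism A -> {mpoly A[0]}} := @mpolyC 0 A.
  apply: (noetherian_surj (f := f) _ nA).
  by apply: mpoly_rmorph_surj => [c|[]//]; exists c.
pose f : {rmorphism {poly {mpoly A[n]}} -> {mpoly A[n.+1]}} :=
  horner_morph (fun x => mulrC 'X_ord_max (mwiden x)).
apply: (noetherian_surj (f := f)).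
apply: mpoly_rmorph_surj => [c|i].
  by exists (c%:MP)%:P; rewrite /f /= horner_morphC /= mwidenC.
have [j ->|->] := unliftP ord_max i; last first.
  by exists 'X; rewrite /f /= horner_morphX.
exists ('X_j)%:P; rewrite /f /= horner_morphC /= mwidenX mnmwiden1; congr 'X_[U_( _)].
by apply/val_inj => /=; rewrite /bump leqNgt ltn_ord.
Qed.

(** * Powers, localization and associated primes *)

Section Powers.
Variable A : comNzRingType.
Implicit Types (J K L : set A).

Lemma sum_of_productsM J K x y : J x -> K y -> sum_of_products J K (x * y).
Proof.
by move=> Jx Ky; exists 1%N, (fun=> x), (fun=> y); split=> //; rewrite big_ord1.
Qed.

Lemma sum_of_products_ideal J K : ideal K -> ideal (sum_of_products J K).
Proof.
move=> iK; split.
- by exists 0%N, (fun=> 0), (fun=> 0); split=> [[]//|[]//|]; rewrite big_ord0.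
- move=> _ _ [m [a [b [Ja Kb ->]]]] [n [c [d [Jc Kd ->]]]].
  pose h (T : Type) (u : 'I_m -> T) (v : 'I_n -> T) i :=
    match split i with inl j => u j | inr j => v j end.
  exists (m + n)%N, (h _ a c), (h _ b d).
  split; try by move=> i; rewrite /h; case: split.
  rewrite big_split_ord /h /=; congr (_ + _); apply: eq_bigr => i _.
    by rewrite -[lshift n i]/(unsplit (inl i)) unsplitK.
  by rewrite -[rshift m i]/(unsplit (inr i)) unsplitK.
- move=> c _ [m [a [b [Ja Kb ->]]]]; exists m, a, (fun i => c * b i).
  split=> // [i|]; first exact: ideal_mull.
  by rewrite mulr_sumr; apply: eq_bigr => i _; rewrite mulrCA.
Qed.

Lemma sum_of_products_min J K L : ideal L ->
  (forall x y, J x -> K y -> L (x * y)) -> sum_of_products J K `<=` L.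
Proof.
by move=> iL JK _ [n [a [b [Ja Kb ->]]]]; apply: ideal_sum => // i _; apply: JK.
Qed.

Lemma exp_ideal J n : ideal (ideal_exp J n).
Proof.
case: n => [|n]; first by split.
by elim: n => [|n IH]; apply: sum_of_products_ideal.
Qed.

Lemma exp_mul J m n x y :
  ideal_exp J m x -> ideal_exp J n y -> ideal_exp J (m + n) (x * y).
Proof.
move=> + Jy; elim: m x => [|m IH] x; first by move=> _; apply: ideal_mull => //; exact: exp_ideal.
move: x; apply: sum_of_products_min; first exact: (colon_ideal _ (exp_ideal _ _)).
by move=> a b Ja /IH Jb; rewrite -[X in _ X]/(a * b * y) -mulrA; apply: sum_of_productsM.
Qed.

Lemma exp_S J n : ideal_exp J n.+1 `<=` ideal_exp J n.
Proof.
apply: sum_of_products_min; first exact: exp_ideal.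
by move=> x y _ Jy; apply: ideal_mull => //; exact: exp_ideal.
Qed.

Lemma exp_le J m n : (m <= n)%N -> ideal_exp J n `<=` ideal_exp J m.
Proof. by move=> /subnK <-; elim: (n - m)%N => [//|d IH] x /exp_S /IH. Qed.

Lemma exp1 J : ideal J -> ideal_exp J 1 `<=` J.
Proof. by move=> iJ; apply: sum_of_products_min => // x y Jx _; apply: ideal_mulr. Qed.

Lemma exp_sub J n : ideal J -> (0 < n)%N -> ideal_exp J n `<=` J.
Proof. by move=> iJ n0; apply: subset_trans (exp1 iJ); apply: exp_le. Qed.

Lemma expX J n x : J x -> ideal_exp J n (x ^+ n).
Proof. by move=> Jx; elim: n => [//|n IH]; rewrite exprS; apply: sum_of_productsM. Qed.

Lemma exp_expS J m n : ideal_exp (ideal_exp J m) n `<=` ideal_exp J (m * n).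
Proof.
elim: n => [|n IH]; first by rewrite muln0.
apply: sum_of_products_min; first exact: exp_ideal.
by move=> x y Jx /IH Jy; rewrite mulnS; apply: exp_mul.
Qed.

End Powers.

Definition is_prime (A : comNzRingType) (p : set A) : Prop :=
  [/\ ideal p, ~ p 1 & forall x y, p (x * y) -> p x \/ p y].

Lemma idealr_closed_ideal (A : comNzRingType) (J : set A) :
  idealr_closed [pred x in J] -> ideal J /\ ~ J 1.
Proof.
move=> [J0 J1 JD]; have H x : (x \in [pred x in J]) = (x \in J) by [].
move: J0 J1; rewrite !H !in_setE => J0 J1.
have JDx a x y : J x -> J y -> J (a * x + y).
  by move=> Jx Jy; have := JD a x y; rewrite !H !in_setE; apply.
split; last by move=> ?; move/negP: J1; apply; rewrite in_setE.
split=> // [x y Jx Jy|a x Jx]; first by rewrite -[x]mul1r; apply: JDx.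
by rewrite -[_ * _]addr0; apply: JDx.
Qed.

Lemma prime_idealP (A : comNzRingType) (p : set A) : prime_ideal p <-> is_prime p.
Proof.
have H x : (x \in [pred x in p]) = (x \in p) by [].
split=> [[/idealr_closed_ideal[ip p1] pp]|[ip p1 pp]].
  split=> // x y pxy; have := pp x y; rewrite !H !in_setE.
  by move=> /(_ pxy)/orP[] /set_mem; [left|right].
split.
  split.
  - by rewrite H in_setE; exact: ideal_0.
  - by rewrite H; apply/negP => /set_mem.
  - by move=> a x y; rewrite !H !in_setE => px py; apply: ideal_add => //; apply: ideal_mull.
by move=> x y; rewrite !H !in_setE => /pp[] px; apply/orP; [left|right]; apply/mem_set.
Qed.

(* The contraction to [A] of the extension of [K] to the localization at [p]. *)
Definition loc (A : comNzRingType) (p K : set A) : set A :=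
  [set f | exists s, ~ p s /\ K (s * f)].

Section Loc.
Variable A : comNzRingType.
Implicit Types (p J K L : set A).

Lemma primeM p x y : is_prime p -> ~ p x -> ~ p y -> ~ p (x * y).
Proof. by move=> [_ _ pp] nx ny /pp[]. Qed.

Lemma prime_ideal_ideal p : is_prime p -> ideal p. Proof. by case. Qed.

Lemma prime_exp p J n : is_prime p -> ideal_exp J n `<=` p -> J `<=` p.
Proof.
move=> [ip p1 pp]; elim: n => [Jp|n IH Jp x Jx]; first by case: p1; apply: Jp.
have [//|npx] := pselect (p x); apply: (IH _ _ Jx) => y Jy.
by have [/npx|] := pp x y (Jp _ (sum_of_productsM Jx Jy)).
Qed.

Lemma loc_ideal p K : is_prime p -> ideal K -> ideal (loc p K).
Proof.
move=> pp iK; have [ip p1 _] := pp; split.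
- by exists 1; split=> //; rewrite mulr0; exact: ideal_0.
- move=> x y [s [ps Ks]] [t [pt Kt]]; exists (s * t); split; first exact: primeM.
  rewrite mulrDr; apply: ideal_add => //; last by rewrite -mulrA; apply: ideal_mull.
  by rewrite mulrAC; apply: ideal_mulr.
- by move=> a x [s [ps Ks]]; exists s; split=> //; rewrite mulrCA; apply: ideal_mull.
Qed.

Lemma sub_loc p K : is_prime p -> K `<=` loc p K.
Proof. by move=> [_ p1 _] x Kx; exists 1; rewrite mul1r. Qed.

Lemma loc_mono p q K L : p `<=` q -> K `<=` L -> loc q K `<=` loc p L.
Proof. by move=> pq KL x [s [qs Ks]]; exists s; split; [move=> /pq|apply: KL]. Qed.

Lemma loc_loc p K : is_prime p -> loc p (loc p K) `<=` loc p K.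
Proof.
move=> pp x [s [ps [t [pt Kt]]]]; exists (t * s); split; first exact: primeM.
by rewrite -mulrA.
Qed.

Lemma loc_exp p J K m : is_prime p -> J `<=` loc p K ->
  ideal_exp J m `<=` loc p (ideal_exp K m).
Proof.
move=> pp JK; elim: m => [|m IH]; first by move=> x _; exact: sub_loc.
apply: sum_of_products_min; first exact: (loc_ideal pp (exp_ideal _ _)).
move=> x y /JK[s [ps Ks]] /IH[t [pt Kt]].
exists (s * t); split; first exact: primeM.
by rewrite mulrACA; apply: sum_of_productsM.
Qed.

End Loc.

Section Ass.
Variable A : comNzRingType.
Implicit Types (p J : set A).

Lemma Ass_prime J p : Ass J p -> is_prime p.
Proof. by move=> [/prime_idealP]. Qed.

Lemma sub_Ass J p : ideal J -> Ass J p -> J `<=` p.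
Proof. by move=> iJ [_ [f ->]] r Jr /=; apply: ideal_mulr. Qed.

Hypothesis nA : noetherian A.

(* A maximal annihilator of a multiple of [f] is prime. *)
Lemma exists_Ass J f : ideal J -> ~ J f ->
  exists p, Ass J p /\ forall r, J (r * f) -> p r.
Proof.
move=> iJ nf.
suff H K : ideal K -> forall g, ~ J (g * f) -> K = [set r | J (r * (g * f))] ->
    exists p, Ass J p /\ forall r, J (r * f) -> p r.
  by apply: (H _ (colon_ideal f iJ) 1); rewrite mul1r.
move: K; apply: (noetherian_ind nA) => K iK IH g ng defK.
have [[h [nh nsub]]|nex] := pselect (exists h, ~ J (h * (g * f)) /\
    ~ ([set r | J (r * (h * (g * f)))] `<=` K)).
  apply: (IH _ (colon_ideal (h * (g * f)) iJ) _ nsub (h * g)); rewrite -?mulrA //.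
  by rewrite defK => r /= Jr; rewrite mulrCA; apply: ideal_mull.
exists K; split; last first.
  by rewrite defK => r /= Jr; rewrite mulrCA; apply: ideal_mull.
split; last by exists (g * f).
apply/prime_idealP; split=> //; first by rewrite defK /= mul1r.
move=> x y Kxy; have [Ky|nKy] := pselect (K y); first by right.
left; apply: contrapT => nKx; apply: nex; exists y; split; first by move: nKy; rewrite defK.
by move=> sub; apply/nKx/sub => /=; rewrite mulrA; move: Kxy; rewrite defK.
Qed.

End Ass.

(* Noetherian induction: if [(a : H) = Q] is prime, then a prime contraction of
   [(a : F)] that is not one of [(a + (H) : F)] is the contraction of [Q]. *)
Lemma finite_contracted_primes (A B : comNzRingType) (i : {rmorphism A -> B}) :
    noetherian B -> forall a : set B, ideal a ->
  exists n (P : nat -> set A), forall p F, is_prime p ->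
    p = [set r | a (i r * F)] -> exists2 j, (j < n)%N & p = P j.
Proof.
move=> nB; apply: (noetherian_ind nB) => a ia IH.
have [a1|na1] := pselect (a 1).
  exists 0%N, (fun=> setT) => p F [_ p1 _] defp; case: p1; rewrite defp /=.
  by rewrite rmorph1 mul1r -[F]mulr1; apply: ideal_mull.
have [Q [[/prime_idealP pQ [H defQ]] _]] := exists_Ass nB ia na1.
have naH : ~ a H by have [_ + _] := pQ; rewrite defQ /= mul1r.
have ia' := adjoin_ideal H ia.
have [|n [P HP]] := IH _ ia' (@sub_adjoin _ H a).
  by move=> /(_ _ (adjoin_gen H ia)).
exists n.+1, (fun j => if j == n then [set r | Q (i r)] else P j) => p F pp defp.
have [eqp|neqp] := pselect (p = [set r | adjoin H a (i r * F)]).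
  have [j jn ->] := HP _ _ pp eqp; exists j; first exact: ltnW.
  by rewrite ltn_eqF.
exists n; rewrite ?eqxx //.
(* Here [i r * F] and [c * H] agree modulo [a]. As [r] is outside [p] and [c] outside [Q], both [p]
   and the contraction of [Q] are the set of [x] with [i x * (c * H)] in [a]. *)
have [r [nr [c [y [ay rF]]]]] : exists r, ~ p r /\ adjoin H a (i r * F).
  apply: contrapT => nex; apply: neqp; apply/seteqP; split=> r.
  by rewrite {1}defp /= => ar; exact: sub_adjoin.
  by move=> /= ar; apply: contrapT => nr; apply: nex; exists r.
have [ip _ ppM] := pp.
have ncH : ~ a (c * H).
  by move=> acH; apply: nr; rewrite defp /= rF; apply: ideal_add.
have acH x : a (x * (c * H)) <-> a (x * (i r * F)).
  rewrite rF mulrDr; split=> ax; first by apply: ideal_add => //; apply: ideal_mull.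
  by rewrite -(addrK (x * y) (x * (c * H))); apply: ideal_sub => //; apply: ideal_mull.
have nQc : ~ Q c by rewrite defQ.
have [iQ _ pQM] := pQ.
apply/seteqP; split=> x /=.
  rewrite {1}defp /= => ax; have /pQM[//|/nQc//] : Q (i x * c).
  by rewrite defQ /= -mulrA; apply/acH; rewrite mulrCA; apply: ideal_mull.
move=> Qx; have : p (x * r).
  rewrite defp /= rmorphM -mulrA; apply/acH.
  by rewrite mulrCA; apply: ideal_mull => //; move: Qx; rewrite defQ.
by move=> /ppM[].
Qed.

(** * Symbolic powers *)

Section SymbolicPowers.
Variable R : idomainType.
Implicit Types (p q I J K : set R).

(** Finitely many fractions have a common denominator outside [p], and [tofrac] is injective. All
    later localization then takes place inside the ring, through [loc]. *)
Lemma local_extensionP p K f : is_prime p -> ideal K ->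
  local_extension p K (tofrac f) <-> loc p K f.
Proof.
move=> pp iK; have [ip p1 _] := pp.
have nz s : ~ p s -> tofrac s != 0.
  by move=> ps; rewrite tofrac_eq0; apply/eqP => s0; apply: ps; rewrite s0; exact: ideal_0.
split=> [[n [a [b [pa Kb]]]]|[s [ps Ksf]]]; last first.
  rewrite -(mulKf (nz _ ps) (tofrac f)) -tofracM.
  apply: sum_of_productsM; last by exists (s * f).
  by exists 1, s; rewrite tofrac1 div1r.
move=> fE.
suff [s [ps [g Kg sgE]]] : exists s, ~ p s /\
    exists2 g, K g & tofrac s * \sum_(i < n) a i * b i = tofrac g.
  exists s; split=> //; rewrite -fE -tofracM in sgE.
  by move/eqP: sgE; rewrite tofrac_eq => /eqP ->.
clear f fE; elim: n a b pa Kb => [|n IH] a b pa Kb.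
  by exists 1; split=> //; exists 0; [exact: ideal_0|rewrite big_ord0 mulr0 tofrac0].
have [|//|s [ps [g Kg sgE]]] := IH (fun i => a (lift ord0 i)) (fun i => b (lift ord0 i)).
  by move=> i.
have [u [t [pt aE]]] := pa ord0; have [v Kv bE] := Kb ord0.
exists (t * s); split; first exact: primeM.
exists (s * u * v + t * g).
  by apply: ideal_add => //; apply: ideal_mull.
rewrite big_ord_recl tofracD !tofracM -sgE aE -bE.
by have := nz _ pt; move=> ?; field.
Qed.

Lemma symbolic_powerE J m f : ideal J ->
  symbolic_power J m f <-> forall p, Ass J p -> loc p (ideal_exp J m) f.
Proof.
move=> iJ; split=> H p Jp; first by apply/(local_extensionP _ (Ass_prime Jp))/H/Jp/exp_ideal.
by apply/(local_extensionP _ (Ass_prime Jp)); [exact: exp_ideal|apply: H].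
Qed.

Lemma symbolic_power_ideal J m : ideal J -> ideal (symbolic_power J m).
Proof.
move=> iJ; have iL p : Ass J p -> ideal (loc p (ideal_exp J m)).
  by move=> Jp; apply: loc_ideal (Ass_prime Jp) (exp_ideal _ _).
split=> [|x y|a x].
- by apply/symbolic_powerE => // p /iL; exact: ideal_0.
- move=> /(symbolic_powerE _ _ iJ) Hx /(symbolic_powerE _ _ iJ) Hy.
  by apply/symbolic_powerE => // p Jp; apply: (ideal_add (iL p Jp)); [apply: Hx|apply: Hy].
- move=> /(symbolic_powerE _ _ iJ) Hx.
  by apply/symbolic_powerE => // p Jp; apply: (ideal_mull (iL p Jp)); apply: Hx.
Qed.

Lemma sub_symbolic_power J m : ideal J -> ideal_exp J m `<=` symbolic_power J m.
Proof.
by move=> iJ x Jx; apply/symbolic_powerE => // p Jp; apply: sub_loc => //; apply: Ass_prime Jp.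
Qed.

Section AssSymbolicPower.
Variables (I : set R) (t : nat).
Hypothesis iI : ideal I.
Let J := symbolic_power I t.

(** Let [p = (J : f)]. If each [q] in [Ass I] misses some [r] of [p], then [r * f] in [J] and [r]
    invertible at [q] put [f] in every localization of [I^t], so [f] is in [J]. *)
Lemma Ass_symbolic_power_sub p : Ass J p -> exists2 q, Ass I q & p `<=` q.
Proof.
move=> Jp; have pp := Ass_prime Jp; case: Jp => _ [f pE].
have nJf : ~ J f by have [_ + _] := pp; rewrite pE /= mul1r.
apply: contrapT => nex; apply: nJf; apply/symbolic_powerE => // q Iq.
have [r [pr nqr]] : exists r, p r /\ ~ q r.
  apply: contrapT => nr; apply: nex; exists q => // r pr.
  by apply: contrapT => nqr; apply: nr; exists r.
apply: loc_loc (Ass_prime Iq) _ _; exists r; split=> //.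
by move: pr; rewrite pE => /(symbolic_powerE _ _ iI); apply.
Qed.

Lemma symbolic_power_sub_loc p : Ass J p -> J `<=` loc p (ideal_exp I t).
Proof.
move=> /Ass_symbolic_power_sub[q Iq pq] f /(symbolic_powerE _ _ iI) /(_ q Iq).
exact: loc_mono.
Qed.

Lemma symbolic_power_symbolic_power_sub m p : Ass J p ->
  symbolic_power J m `<=` loc p (ideal_exp I (t * m)).
Proof.
move=> Jp f /(symbolic_powerE _ _ (symbolic_power_ideal _ iI)) /(_ p Jp) Jf.
have pp := Ass_prime Jp; apply: loc_loc => //.
apply: loc_mono Jf => //; apply: subset_trans (loc_exp pp (symbolic_power_sub_loc Jp)) _.
by apply: loc_mono => //; exact: exp_expS.
Qed.

Hypothesis nR : noetherian R.

(** This half of [J = I_S^(t)] bounds [alpha(J)] from above. If [f] is not in [J], some [p] in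
    [Ass J] contains [(J : f)], but a denominator of [f] at [p] lies in [(J : f)] and outside
    [p]. *)
Lemma loc_sub_symbolic_power f :
  (forall p, Ass J p -> loc p (ideal_exp I t) f) -> J f.
Proof.
move=> H; apply: contrapT => nJf.
have [p [Jp subp]] := exists_Ass nR (symbolic_power_ideal _ iI) nJf.
by have [s [ps /(sub_symbolic_power iI)/subp]] := H p Jp.
Qed.

(** Reduces symbolic to ordinary powers. If [p = (J : f)], then [p] is finitely generated, so one
    [u] outside [q] clears the denominators of all products of [f] with generators; [u] is also
    outside [p], whence [p = (I^t : u f)]. *)
Lemma Ass_symbolic_power_exp p : Ass J p ->
  exists g, p = [set r | ideal_exp I t (r * g)].
Proof.
move=> Jp; have pp := Ass_prime Jp; have [q Iq pq] := Ass_symbolic_power_sub Jp.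
case: Jp => _ [f pE]; have pq' := Ass_prime Iq.
have [s [sp spE]] := noetherian_fg nR (prime_ideal_ideal pp).
have [u [nqu Hu]] : exists u, ~ q u /\ forall r, r \in s -> ideal_exp I t (r * (u * f)).
  elim: s sp {spE} => [_|a s IH sp]; first by exists 1; split => //; case: pq'.
  have [|u [nqu Hu]] := IH; first by move=> r rs; apply: sp; rewrite inE rs orbT.
  have := sp a (mem_head _ _); rewrite pE => /(symbolic_powerE _ _ iI)/(_ q Iq)[v [nqv Iv]].
  exists (v * u); split; first exact: primeM.
  move=> r; rewrite inE => /predU1P[->|/Hu Ir].
    have -> : a * (v * u * f) = u * (v * (a * f)) by ring.
    by apply: ideal_mull => //; exact: exp_ideal.
  have -> : r * (v * u * f) = v * (r * (u * f)) by ring.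
  by apply: ideal_mull => //; exact: exp_ideal.
exists (u * f); apply/seteqP; split=> r.
  move=> /spE; move: r; apply: gen_min => //; exact: (colon_ideal _ (exp_ideal _ _)).
move=> /= /(sub_symbolic_power iI); rewrite mulrA => Jruf.
have [_ _ /(_ r u)[|//|/pq//]] := pp.
by rewrite pE.
Qed.

End AssSymbolicPower.

(** Take the largest [j] such that [I^j] contains some [r * f] with [r] outside [p]. Then [p] is the
    annihilator of the class of [r * f] in [I^j / I^{j+1}], so [p] is visible on the associated
    graded ring. *)
Lemma exp_colon_step I t f p : is_prime p ->
    p = [set r | ideal_exp I t (r * f)] ->
  exists j g, ideal_exp I j g /\ p = [set r | ideal_exp I j.+1 (r * g)].
Proof.
move=> pp pE; have [ip p1 ppM] := pp.
pose Q j := `[< exists2 r, ~ p r & ideal_exp I j (r * f) >].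
have Q0 : exists j, Q j by exists 0%N; apply/asboolP; exists 1.
have Qt j : Q j -> (j <= t)%N.
  move=> /asboolP[r nr Ir]; rewrite leqNgt; apply/negP => tj.
  by apply: nr; rewrite pE /=; apply: exp_le Ir; apply: ltnW.
case: (ex_maxnP Q0 Qt) => j /asboolP[r nr Ir] jmax.
exists j, (r * f); split=> //.
have jt : (j < t)%N.
  rewrite ltn_neqAle Qt ?andbT; last by apply/asboolP; exists r.
  by apply/eqP => jt; apply: nr; rewrite pE /= -jt.
apply/seteqP; split=> s /= => [ps|Is].
  apply: (exp_le jt); rewrite mulrCA; apply: ideal_mull; first exact: exp_ideal.
  by move: ps; rewrite {1}pE.
apply: contrapT => nps; suff /jmax : Q j.+1 by rewrite ltnn.
by apply/asboolP; exists (s * r); [exact: primeM|rewrite -mulrA].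
Qed.

End SymbolicPowers.

(** The presentation of the Rees algebra of the ideal [gen s]: its image consists of the polynomials
    whose coefficient of degree [j] lies in the [j]-th power of that ideal. *)
Definition rees (R : comNzRingType) (s : seq R) (F : {mpoly R[size s]}) : {poly R} :=
  mmap (@polyC R) (fun i => s`_i *: 'X) F.

Arguments rees [R] s F.

Section Rees.
Variables (R : comNzRingType) (s : seq R).
Let I := gen s.

Lemma rees_coef F j : ideal_exp I j (rees s F)`_j.
Proof.
rewrite /rees /mmap coef_sum; apply: ideal_sum; first exact: exp_ideal.
move=> m _; rewrite coefCM; apply: ideal_mull; first exact: exp_ideal.
rewrite /mmap1.
suff: forall (r : seq 'I_(size s)) j,
    ideal_exp I j (\prod_(i <- r) ((s`_i *: 'X) ^+ m i : {poly R}))`_j.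
  exact.
elim=> [|i r IH] {}j.
  rewrite big_nil coef1; case: j => [//|j].
  exact: (ideal_0 (exp_ideal _ _)).
rewrite big_cons coefM; apply: ideal_sum; first exact: exp_ideal.
move=> l _; rewrite -[in ideal_exp _ _](subnKC (ltn_ord l : (l <= j)%N)).
apply: exp_mul; last exact: IH.
rewrite exprZn coefZ coefXn; have [->|_] := eqVneq; last first.
  by rewrite mulr0; exact: (ideal_0 (exp_ideal _ _)).
by rewrite mulr1; apply/expX/gen_mem/mem_nth.
Qed.

Lemma rees_surj j g : ideal_exp I j g -> exists F, rees s F = g *: 'X^j.
Proof.
elim: j g => [g _|j IH].
  by exists g%:MP; rewrite /rees mmapC expr0 alg_polyC.
pose T : set R := [set g : R | exists F, rees s F = g *: 'X^(j.+1)].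
have iT : ideal T.
  split=> [|x y [F FE] [G GE]|a x [F FE]].
  - by exists 0; rewrite /rees rmorph0 scale0r.
  - by exists (F + G); rewrite /rees rmorphD scalerDl -FE -GE.
  - by exists (a%:MP * F); rewrite /rees rmorphM /= mmapC mul_polyC -scalerA -FE.
apply: sum_of_products_min => // x y + /IH[F FE].
move: x; apply: gen_min; first exact: (colon_ideal _ iT).
move=> a /(nthP 0)[i lti <-] /=; exists ('X_(Ordinal lti) * F).
rewrite /rees rmorphM /= mmapX mmap1U; rewrite /rees in FE; rewrite FE /=.
by rewrite -scalerAl -scalerAr scalerA -exprS.
Qed.

(* Brodmann: these primes are contractions of colons of the ideal defining the
   associated graded ring of [I] as a quotient of a polynomial ring. *)
Lemma finite_primes_exp : noetherian R ->
  exists n (P : nat -> set R), forall p j g, is_prime p -> ideal_exp I j g ->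
    p = [set r | ideal_exp I j.+1 (r * g)] -> exists2 i, (i < n)%N & p = P i.
Proof.
(* The preimage of the sum of the [I^{j+1} X^j]; the quotient by it is the associated graded ring.
   If [F] maps to [g X^j], then [(a : F)] contracts to the [r] with [r * g] in [I^{j+1}]. *)
move=> nR; pose a : set {mpoly R[size s]} :=
  [set F | forall j, ideal_exp I j.+1 (rees s F)`_j].
have ia : ideal a.
  split=> [|F G aF aG|F G aG] j.
  - rewrite /rees rmorph0 coef0; exact: (ideal_0 (exp_ideal _ _)).
  - rewrite /rees rmorphD coefD; apply: (ideal_add (exp_ideal _ _)); [exact: aF|exact: aG].
  - rewrite /rees rmorphM coefM; apply: ideal_sum; first exact: exp_ideal.
    move=> l _; rewrite -[in ideal_exp _ _](subnKC (ltn_ord l : (l <= j)%N)) -addnS.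
    by apply: exp_mul; [exact: rees_coef|exact: aG].
have [n [P HP]] := finite_contracted_primes (@mpolyC (size s) R) (noetherian_mpoly nR) ia.
exists n, P => p j g pp /rees_surj[F FE] pE; apply: (HP p F) => //.
have reesE r i : (rees s (r%:MP * F))`_i = (r * g) * (i == j)%:R.
  by rewrite /rees rmorphM /= mmapC mul_polyC -/(rees s F) FE scalerA coefZ coefXn.
rewrite pE; apply/seteqP; split=> r /= => [Ir i|/(_ j)].
  rewrite reesE; have [->|_] := eqVneq; first by rewrite mulr1.
  by rewrite mulr0; exact: (ideal_0 (exp_ideal _ _)).
by rewrite reesE eqxx mulr1.
Qed.

End Rees.

Lemma finite_Ass_symbolic_powers (R : idomainType) (I : set R) :
    noetherian R -> ideal I ->
  exists n (P : nat -> set R), forall t p, Ass (symbolic_power I t) p ->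
    exists2 i, (i < n)%N & p = P i.
Proof.
move=> nR iI; have [s [sI Is]] := noetherian_fg nR iI.
have -> : I = gen s by apply/seteqP; split=> //; apply: gen_min.
have [n [P HP]] := finite_primes_exp s nR; exists n, P => t p Jp.
have pp := Ass_prime Jp.
have [g pE] := Ass_symbolic_power_exp (gen_ideal s) nR Jp.
have [j [h [Ih pE']]] := exp_colon_step pp pE.
exact: (HP p j h).
Qed.

(** * Degrees *)

(** Order at least [d] modulo [p]. It serves with [p] prime for Taylor expansions, and with [p] zero
    for the order itself. *)
Definition low_coefs_in (A : comNzRingType) n (p : set A) (d : nat) (F : {mpoly A[n]}) :=
  forall m, (mdeg m < d)%N -> p F@_m.

Section LowCoefs.
Variables (A : comNzRingType) (n : nat) (p : set A).
Hypothesis ip : ideal p.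
Implicit Types F G : {mpoly A[n]}.

Lemma low_coefs_inD d F G :
  low_coefs_in p d F -> low_coefs_in p d G -> low_coefs_in p d (F + G).
Proof. by move=> pF pG m md; rewrite mcoeffD; apply: ideal_add; auto. Qed.

Lemma low_coefs_inM d e F G :
  low_coefs_in p d F -> low_coefs_in p e G -> low_coefs_in p (d + e) (F * G).
Proof.
move=> pF pG m md; rewrite mcoeffM; apply: ideal_sum => // -[k l] /= /eqP mE.
have [kd|dk] := ltnP (mdeg k) d; first by apply: ideal_mulr => //; apply: pF.
apply: ideal_mull => //; apply: pG.
by rewrite -(ltn_add2l (mdeg k)) -mdegD -mE (leq_trans md) // leq_add2r.
Qed.

(** With [c] the constant term of [F], the difference [c - F] has order at least 1, so
    [c G = F G + (c - F) G] gains one order over [G]; then [c] cancels because [p] is prime. *)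
Lemma low_coefs_in_cancel d F G : is_prime p -> ~ p F@_0 ->
  low_coefs_in p d (F * G) -> low_coefs_in p d G.
Proof.
move=> [_ _ pp] nF0 pFG; suff H j : (j <= d)%N -> low_coefs_in p j G by apply: H.
elim: j => [//|j IH] jd; have {IH} pG := IH (ltnW jd).
pose c := (F@_0)%:MP_[n].
have pFc : low_coefs_in p 1 (c - F).
  move=> m; rewrite ltnS leqn0 mdeg_eq0 => /eqP ->.
  by rewrite mcoeffB mcoeffC eqxx mulr1 subrr; exact: ideal_0.
move=> m mj; suff /pp[/nF0|] : p (F@_0 * G@_m) by [].
have -> : F@_0 * G@_m = (F * G + (c - F) * G)@_m.
  by rewrite -mulrDl addrC subrK mul_mpolyC mcoeffZ.
apply: low_coefs_inD mj; last exact: (low_coefs_inM pFc pG).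
by move=> l lj; apply/pFG/(leq_trans lj).
Qed.

End LowCoefs.

Section Taylor.
Variables (k : fieldType) (n : nat).
Implicit Types (f : {mpoly k[n]}).

(* f(x + z), as a polynomial in z over k[x] *)
Definition taylor : {rmorphism {mpoly k[n]} -> {mpoly {mpoly k[n]}[n]}} :=
  mmap (@mpolyC n {mpoly k[n]} \o @mpolyC n k) (fun i => ('X_i)%:MP + 'X_i).

Lemma taylor_coef0 f : (taylor f)@_0 = f.
Proof.
rewrite [RHS]mpolyE /taylor /mmap raddf_sum /=; apply: eq_bigr => m _.
rewrite mcoeffCM mpolyXE_id mul_mpolyC; congr (_ *: _).
rewrite /mmap1 rmorph_prod; apply: eq_bigr => i _; rewrite rmorphXn /=; congr (_ ^+ _).
by rewrite mcoeffD mcoeffC eqxx mulr1 mcoeffX mnm1_eq0 addr0.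
Qed.

Lemma msizeM_leq (R : idomainType) (F G : {mpoly R[n]}) a b :
  (msize F <= a.+1)%N -> (msize G <= b)%N -> (msize (F * G) <= a + b)%N.
Proof.
have [->|F0] := eqVneq F 0; first by rewrite mul0r msize0.
have [->|G0] := eqVneq G 0; first by rewrite mulr0 msize0.
rewrite msizeM //; lia.
Qed.

(** The product of the [(x_i + z_i)^(m i)] is [z^m] plus terms of lower degree in [z]. The relation
    [P d F G] says that [G] has degree at most [d] and [F - G] has smaller degree; it is
    multiplicative, which reduces the claim to single factors. *)
Lemma taylorX_top (m : 'X_{1..n}) :
  (msize (taylor 'X_[m] - 'X_[m])%R <= mdeg m)%N.
Proof.
pose P d (F G : {mpoly {mpoly k[n]}[n]}) := (msize G <= d.+1)%N /\ (msize (F - G)%R <= d)%N.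
have PM d e F G F' G' : P d F G -> P e F' G' -> P (d + e)%N (F * F') (G * G').
  move=> [Gd FG] [Ge FG']; split; first by rewrite -addnS; apply: msizeM_leq.
  have -> : F * F' - G * G' = G * (F' - G') + F' * (F - G) by ring.
  apply: leq_trans (msizeD_le _ _) _; rewrite geq_max msizeM_leq //=.
  rewrite addnC msizeM_leq // -[F'](subrK G').
  by apply: leq_trans (msizeD_le _ _) _; rewrite geq_max Ge (leq_trans FG').
suff [] : P (mdeg m) (taylor 'X_[m]) 'X_[m] by [].
have P1 : P 0%N 1 1 by split; rewrite ?subrr ?msize0 ?msize1.
rewrite /taylor /= mmapX mpolyXE_id mdegE /mmap1.
apply: (big_ind3 P P1) => [d F G e F' G'|i _]; first exact: PM.
elim: (m i) => [//|j IH]; rewrite !exprS -add1n; apply: PM => //.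
by split; rewrite ?addrK ?msizeC ?msizeX ?mdeg1 // leq_b1.
Qed.

(** The leading monomial has maximal degree, and the expansion of [x^m] has only [z^m] in degree
    [mdeg m] or above; so no other monomial of [f] contributes. *)
Lemma taylor_lead f : f != 0 -> (taylor f)@_(mlead f) = (mleadc f)%:MP.
Proof.
move=> f0; have topX m : m \in msupp f ->
    (taylor 'X_[m])@_(mlead f) = (m == mlead f)%:R.
  move=> mf; rewrite -(subrK 'X_[m] (taylor 'X_[m])) mcoeffD mcoeffX.
  rewrite memN_msupp_eq0 ?add0r //; apply: msize_mdeg_ge.
  apply: leq_trans (taylorX_top m) _.
  by rewrite -ltnS mlead_deg //; apply: msize_mdeg_lt.
rewrite {1}/taylor /= /mmap raddf_sum /= (bigD1_seq (mlead f)) ?mlead_supp ?msupp_uniq //=.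
rewrite big_seq_cond big1 ?addr0 => [|m /andP[mf /negbTE ne]].
  by rewrite mcoeffCM -(mmapX _ (@mpolyC n _ \o @mpolyC n k)) topX ?mlead_supp // eqxx mulr1.
by rewrite mcoeffCM -(mmapX _ (@mpolyC n _ \o @mpolyC n k)) topX // ne mulr0.
Qed.

(* The Taylor coefficients of order less than [m] of an element of [p^m] are
   in [p], whereas those of top degree are constants. *)
Lemma loc_exp_degree (p I : set {mpoly k[n]}) m f : is_prime p -> I `<=` p ->
  loc p (ideal_exp I m) f -> f != 0 -> (m <= (msize f).-1)%N.
Proof.
move=> pp Ip [s [ps Isf]] f0; have [ip p1 _] := pp.
have H j x : ideal_exp I j x -> low_coefs_in p j (taylor x).
  move: x; elim: j => [//|j IH].
  apply: sum_of_products_min => [|x y Ix /IH Iy].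
    split=> [|x y lx ly|a x lx].
    - by move=> l _; rewrite raddf0 mcoeff0; exact: ideal_0.
    - by rewrite rmorphD; apply: low_coefs_inD.
    - have la : low_coefs_in p 0 (taylor a) by move=> l; rewrite ltn0.
      by have := low_coefs_inM ip la lx; rewrite -rmorphM add0n.
  have lx : low_coefs_in p 1 (taylor x).
    by move=> l; rewrite ltnS leqn0 mdeg_eq0 => /eqP ->; rewrite taylor_coef0; apply: Ip.
  by have := low_coefs_inM ip lx Iy; rewrite -rmorphM add1n.
move/H: Isf; rewrite rmorphM => /low_coefs_in_cancel-/(_ ip pp).
rewrite taylor_coef0 => /(_ ps) lf; rewrite leqNgt; apply/negP => fm.
have := lf (mlead f); rewrite -ltnS mlead_deg // taylor_lead //.
rewrite -(prednK (_ : 0 < msize f)%N) ?lt0n ?msize_poly_eq0 // ltnS => /(_ fm) pc.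
apply: p1; rewrite -mpolyC1 -(mulVf (_ : mleadc f != 0)) ?mleadc_eq0 //.
by rewrite mpolyCM; apply: ideal_mull.
Qed.

End Taylor.

Section InitialDegree.
Variables (k : fieldType) (n : nat).
Implicit Types (J K : set {mpoly k[n]}).

Lemma initial_degree_spec J f : J f -> f != 0 ->
  degrees J (initial_degree J) /\ forall e, degrees J e -> (initial_degree J <= e)%N.
Proof.
move=> Jf f0; rewrite /initial_degree.
pose Q d := `[< degrees J d >].
have exQ : exists d, Q d by exists (msize f).-1; apply/asboolP; exists f.
case: (ex_minnP exQ) => d /asboolP Jd dmin.
apply: (@xgetPex _ 0%N [set d | degrees J d /\ forall e, degrees J e -> (d <= e)%N]).
by exists d; split=> // e Je; apply/dmin/asboolP.
Qed.

Lemma initial_degree_attained J f : J f -> f != 0 ->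
  exists g, [/\ J g, g != 0 & (msize g).-1 = initial_degree J].
Proof. by move=> Jf f0; have [[g Jg [g0 gE]] _] := initial_degree_spec Jf f0; exists g. Qed.

Lemma initial_degree_le J f : J f -> f != 0 -> (initial_degree J <= (msize f).-1)%N.
Proof. by move=> Jf f0; have [_] := initial_degree_spec Jf f0; apply; exists f. Qed.

Lemma initial_degree_anti J K f : J `<=` K -> J f -> f != 0 ->
  (initial_degree K <= initial_degree J)%N.
Proof.
move=> JK Jf f0; have [g [Jg g0 <-]] := initial_degree_attained Jf f0.
exact: initial_degree_le (JK _ Jg) g0.
Qed.

End InitialDegree.

(* [s] almost minimizes [b s / s], so [b] is nearly linear from [s] on. *)
Lemma subadditive_bound (b : nat -> nat) (N : nat) : (1 < N)%N ->
    (forall i j, b (i + j) <= b i + b j)%N -> (forall i, i <= b i)%N ->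
  exists t0, forall t, (t0 <= t)%N -> forall m, (m * (b t + N - 1) <= N * b (t * m))%N.
Proof.
move=> N1 bD bge.
have [s s0 Hs] : exists2 s, (0 < s)%N & forall i, (2 * b s * i <= 3 * s * b i)%N.
  (* If [s] fails, some [i] has ratio [b i / i] below 2/3 of [b s / s]. Ratios are at least 1, so a
     ratio below [(3/2)^K] can drop in this way fewer than [K] times. *)
  have good K : forall s, (0 < s)%N -> (b s * 2 ^ K < s * 3 ^ K)%N ->
      exists2 s, (0 < s)%N & forall i, (2 * b s * i <= 3 * s * b i)%N.
    elim: K => [|K IH] s s0 sK; first by have := bge s; rewrite !expn0 in sK; lia.
    have [Hs|/existsNP[i /negP]] := pselect (forall i, (2 * b s * i <= 3 * s * b i)%N).
      by exists s.
    rewrite -ltnNge => si; apply: (IH i); first by case: i si => //; rewrite muln0.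
    rewrite -(ltn_pmul2l (_ : 0 < 3 * s)%N) ?muln_gt0 //.
    have e2 : (0 < 2 ^ K)%N by rewrite expn_gt0.
    rewrite !expnS in sK; nia.
  (* Bernoulli: [(3/2)^K >= 1 + K/2], which exceeds [b 1] for [K = 2 * b 1]. *)
  apply: (good (2 * b 1%N)%N 1%N) => //; rewrite mul1n.
  suff H K : ((K + 2) * 2 ^ K <= 2 * 3 ^ K)%N.
    have := H (2 * b 1%N)%N; have : (0 < 2 ^ (2 * b 1%N))%N by rewrite expn_gt0.
    nia.
  elim: K => [//|K IH]; rewrite !expnS; nia.
have bM q i r : (b (q * i + r) <= q * b i + b r)%N.
  elim: q => [|q IH]; first by rewrite !mul0n !add0n.
  by rewrite !mulSn -!addnA; apply: leq_trans (bD _ _) _; rewrite leq_add2l.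
pose C := (s * b 1%N + b 0%N)%N.
(* [C] bounds [b r] for all remainders [r < s]. From this threshold on,
   [3 s (C + N - 1) <= b s * t], and the total [4 * b s * t] stays below [2 N * b s * t]. *)
exists (3 * s * (C + N - 1))%N => t tt0 m.
have tE := divn_eq t s; have rs := ltn_pmod t s0.
set q := (t %/ s)%N in tE; set r := (t %% s)%N in tE rs.
have bt : (b t <= q * b s + C)%N.
  rewrite tE; apply: leq_trans (bM _ _ _) _; rewrite leq_add2l.
  have := bM r 1%N 0%N; rewrite muln1 addn0 => /leq_trans; apply.
  by rewrite leq_add2r leq_mul2r (ltnW rs) orbT.
have bs : (1 <= b s)%N := leq_trans s0 (bge s).
rewrite -(leq_pmul2l (_ : 0 < 3 * s)%N) ?muln_gt0 //.
have h1 := Hs (t * m)%N.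
have h2 : (3 * s * (b t + N - 1) <= 2 * N * b s * t)%N.
  have h3 : (3 * s * (b t + N - 1) <= 3 * s * (q * b s) + 3 * s * (C + N - 1))%N.
    by rewrite -mulnDr leq_mul2l; apply/orP; right; lia.
  have h4 : (3 * s * (q * b s) <= 3 * (b s * t))%N.
    by rewrite tE; nia.
  have h5 : (3 * s * (C + N - 1) <= b s * t)%N by rewrite (leq_trans tt0) // leq_pmull.
  have h6 : (4 * (b s * t) <= 2 * N * (b s * t))%N by rewrite leq_mul2r; lia.
  lia.
have h7 : (m * (3 * s * (b t + N - 1)) <= m * (2 * N * b s * t))%N by rewrite leq_mul2l h2 orbT.
have h8 : (N * (2 * b s * (t * m)) <= N * (3 * s * b (t * m)))%N by rewrite leq_mul2l h1 orbT.
lia.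
Qed.

(** * The case N >= 2 *)

(** The ideal [I_S^(n)] of the overview. *)
Definition loc_exps (A : comNzRingType) (S : set (set A)) (I : set A) (n : nat) : set A :=
  [set f | forall p, S p -> loc p (ideal_exp I n) f].

Lemma deg_mul (k : fieldType) n (f g : {mpoly k[n]}) : f != 0 -> g != 0 ->
  (msize (f * g)).-1 = ((msize f).-1 + (msize g).-1)%N.
Proof.
by move=> f0 g0; rewrite msizeM // (mpolySpred _ f0) (mpolySpred _ g0) addSn addnS.
Qed.

Section LargeDimension.
Variables (k : fieldType) (n : nat).
Implicit Types (I p : set {mpoly k[n]}) (S : set (set {mpoly k[n]})).

Lemma loc_exps_initial_degree_bound N S I g : (1 < N)%N -> I g -> g != 0 ->
    (exists p, S p) -> (forall p, S p -> is_prime p /\ I `<=` p) ->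
  exists t0, forall t, (t0 <= t)%N -> forall m,
    (m * (initial_degree (loc_exps S I t) + N - 1) <=
     N * initial_degree (loc_exps S I (t * m)))%N.
Proof.
move=> N1 Ig g0 [p Sp] HS.
have Sg i : loc_exps S I i (g ^+ i).
  by move=> q /HS[qq _]; apply: sub_loc => //; apply: expX.
apply: (subadditive_bound (b := fun t => initial_degree (loc_exps S I t))) => // [i j|i].
  have [f [If f0 <-]] := initial_degree_attained (Sg i) (expf_neq0 i g0).
  have [h [Ih h0 <-]] := initial_degree_attained (Sg j) (expf_neq0 j g0).
  rewrite -deg_mul //; apply: initial_degree_le; last exact: mulf_neq0.
  move=> q Sq; have [pq _] := HS q Sq.
  have [s [qs Is]] := If q Sq; have [u [qu Iu]] := Ih q Sq.
  by exists (s * u); split; [exact: primeM|rewrite mulrACA; apply: exp_mul].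
have [f [If f0 <-]] := initial_degree_attained (Sg i) (expf_neq0 i g0).
by have [pp Ip] := HS p Sp; apply: loc_exp_degree pp Ip (If p Sp) f0.
Qed.

Lemma symbolic_power_bound N I g : (1 < N)%N -> ideal I -> ~ I 1 -> I g -> g != 0 ->
  exists t0, forall t, (t0 < t)%N -> forall m,
    (m * (initial_degree (symbolic_power I t) + N - 1) <=
     N * initial_degree (symbolic_power (symbolic_power I t) m))%N.
Proof.
move=> N1 iI I1 Ig g0.
have nR : noetherian {mpoly k[n]} := noetherian_mpoly (@noetherian_field k).
have [r [P HP]] := finite_Ass_symbolic_powers nR iI.
pose S (b : {set 'I_r}) := [set p | exists2 i : 'I_r, i \in b & p = P i].
have /choice[T HT] : forall b : {set 'I_r}, exists t0,
    (exists p, S b p) -> (forall p, S b p -> is_prime p /\ I `<=` p) ->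
    forall t, (t0 <= t)%N -> forall m,
    (m * (initial_degree (loc_exps (S b) I t) + N - 1) <=
     N * initial_degree (loc_exps (S b) I (t * m)))%N.
  move=> b; have [[S0 HS]|nS] := pselect ((exists p, S b p) /\
      (forall p, S b p -> is_prime p /\ I `<=` p)); last by exists 0%N => ? ?; case: nS.
  by have [t0 Ht0] := loc_exps_initial_degree_bound N1 Ig g0 S0 HS; exists t0.
(* One threshold for all sets of primes that can be [Ass J]; [b] runs over the subsets of the finite
   index set. *)
exists (\max_b T b)%N => t tt0 m.
set J := symbolic_power I t; have iJ : ideal J := symbolic_power_ideal _ iI.
pose b := finset (fun i : 'I_r => `[< Ass J (P i) >]).
have Sb p : S b p <-> Ass J p.
  split=> [[i ib ->]|Jp]; first by move: ib; rewrite inE => /asboolP.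
  have [i ir pE] := HP t p Jp; exists (Ordinal ir) => //.
  by rewrite inE; apply/asboolP; rewrite -pE.
have t_gt0 : (0 < t)%N := leq_ltn_trans (leq0n _) tt0.
have Jg : J (g ^+ t) by apply: sub_symbolic_power => //; apply: expX.
have Jgm : symbolic_power J m ((g ^+ t) ^+ m) by apply: sub_symbolic_power => //; apply: expX.
(* Uses [t > 0], which the strict inequality [t0 < t] provides; it makes [Ass J] nonempty. *)
have J1 : ~ J 1.
  have [q [Iq _]] := exists_Ass nR iI I1; have pq := Ass_prime Iq.
  move=> /(symbolic_powerE _ _ iI)/(_ q Iq)[s [qs]]; rewrite mulr1.
  by move=> /(exp_sub iI t_gt0)/(sub_Ass iI Iq).
have Sb0 : exists p, S b p by have [p [Jp _]] := exists_Ass nR iJ J1; exists p; apply/Sb.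
have SbP p : S b p -> is_prime p /\ I `<=` p.
  move=> /Sb Jp; have pp := Ass_prime Jp; split=> //.
  apply: (prime_exp pp (n := t)); apply: subset_trans (sub_symbolic_power iI) _.
  exact: sub_Ass.
have tb : (T b <= t)%N := leq_trans (@leq_bigmax _ T b) (ltnW tt0).
have b1 : (initial_degree J <= initial_degree (loc_exps (S b) I t))%N.
  apply: (initial_degree_anti (f := g ^+ t)) => [f If|p /SbP[pp _]|].
  - by apply: loc_sub_symbolic_power => // p /Sb; exact: If.
  - by apply: sub_loc => //; apply: expX.
  - exact: expf_neq0.
have b2 : (initial_degree (loc_exps (S b) I (t * m)) <=
    initial_degree (symbolic_power J m))%N.
  apply: initial_degree_anti Jgm _; last by rewrite !expf_neq0.
  by move=> f Jf p /Sb Jp; apply: symbolic_power_symbolic_power_sub Jf.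
apply: leq_trans (leq_trans (HT b Sb0 SbP t tb m) _); last by rewrite leq_mul2l b2 orbT.
by rewrite leq_mul2l leq_sub2r ?orbT // leq_add2r.
Qed.

End LargeDimension.

(** * Homogeneous ideals, their powers and their lowest components *)

Section Homogeneous.
Variables (k : fieldType) (n : nat).
Implicit Types (J K : set {mpoly k[n]}) (f u : {mpoly k[n]}).

Lemma mcoeff_pihomog d f m : (pihomog mdeg d f)@_m = if mdeg m == d then f@_m else 0.
Proof.
rewrite pihomogE raddf_sum /=; have [md|md] := ifPn; last first.
  rewrite big1_seq // => l /andP[/eqP ld _]; rewrite mcoeffZ mcoeffX.
  have [lm|_] := eqVneq l m; last by rewrite mulr0.
  by rewrite -lm ld eqxx in md.
have [mf|mf] := boolP (m \in msupp f); last first.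
  rewrite (memN_msupp_eq0 mf) big1_seq // => l /andP[_ lf]; rewrite mcoeffZ mcoeffX.
  have [lm|_] := eqVneq l m; last by rewrite mulr0.
  by rewrite -lm lf in mf.
rewrite big_mkcond (bigD1_seq m) ?msupp_uniq //= md mcoeffZ mcoeffX eqxx mulr1.
rewrite big1 ?addr0 // => l /negbTE lm.
by case: ifP => // _; rewrite mcoeffZ mcoeffX lm mulr0.
Qed.

Lemma pihomogMl e d u f : u \is e.-homog ->
  pihomog mdeg (e + d) (u * f) = u * pihomog mdeg d f.
Proof.
move=> ue; apply/mpolyP => m; rewrite mcoeff_pihomog mcoeffM.
have -> : (u * pihomog mdeg d f)@_m = \sum_(l : 'X_{1..n < (mdeg m).+1, (mdeg m).+1} |
    m == (l.1 + l.2)%MM) u@_l.1 * (pihomog mdeg d f)@_l.2 by rewrite mcoeffM.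
case: ifP => md.
  apply: eq_bigr => -[[a aP] [b bP]] /= /eqP mE; rewrite mcoeff_pihomog.
  have [ae|/(dhomog_nemf_coeff ue) ->] := eqVneq (mdeg a) e; last by rewrite !mul0r.
  by move: md; rewrite mE mdegD ae eqn_add2l => ->.
rewrite big1 // => -[[a aP] [b bP]] /= /eqP mE; rewrite mcoeff_pihomog.
have [ae|/(dhomog_nemf_coeff ue) ->] := eqVneq (mdeg a) e; last by rewrite !mul0r.
by move: md; rewrite mE mdegD ae eqn_add2l => ->; rewrite mulr0.
Qed.

Lemma pihomogMl_lt e d u f : u \is e.-homog -> (d < e)%N ->
  pihomog mdeg d (u * f) = 0.
Proof.
move=> ue de; apply/mpolyP => m; rewrite mcoeff_pihomog mcoeffM mcoeff0.
case: ifP => // /eqP md; rewrite big1 // => -[[a aP] [b bP]] /= /eqP mE.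
have [ae|/(dhomog_nemf_coeff ue) ->] := eqVneq (mdeg a) e; last by rewrite !mul0r.
by move: de; rewrite -md mE mdegD ae ltnNge leq_addr.
Qed.

Lemma exp_homogeneous J m : homogeneous J -> homogeneous (ideal_exp J m).
Proof.
move=> hJ; elim: m => [//|m IH] _ [r [a [b [Ja Jb ->]]]] d.
rewrite raddf_sum; apply: ideal_sum => [|i _]; first exact: exp_ideal.
rewrite (pihomog_partitionE (leqnn (msize (a i)))) mulr_suml raddf_sum.
have iJm := exp_ideal J m.+1; apply: ideal_sum => [//|j _] /=.
have [jd|dj] := leqP j d; last first.
  by rewrite (pihomogMl_lt _ (pihomogP _ _ _)) //; exact: (ideal_0 iJm).
rewrite -(subnKC jd) (pihomogMl _ _ (pihomogP _ _ _)).
by apply: sum_of_productsM; [exact: (hJ _ (Ja i))|exact: (IH _ (Jb i))].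
Qed.

Lemma ideal_zero (A : comNzRingType) : ideal [set 0 : A].
Proof. by split=> [|x y -> ->|a x ->] //=; rewrite ?addr0 ?mulr0. Qed.

(** The lowest component of [s * f] is the constant term of [s] times that of [f], so the latter
    lies in [K] and can be split off; [j] counts the degrees left. Thus localizing at the irrelevant
    ideal does not enlarge [K]. *)
Lemma homogeneous_cancel K s f : ideal K -> homogeneous K -> s@_0 != 0 ->
  K (s * f) -> K f.
Proof.
move=> iK hK s0.
suff H j : forall d f, (msize f <= d + j)%N -> low_coefs_in [set 0] d f -> K (s * f) -> K f.
  by apply: (H (msize f) 0%N).
elim: j => [|j IH] d {}f fd lf Ksf.
  suff -> : f = 0 by exact: ideal_0.
  apply/mpolyP => m; rewrite mcoeff0; have [/lf//|dm] := ltnP (mdeg m) d.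
  by apply/memN_msupp_eq0/msize_mdeg_ge; rewrite (leq_trans fd) // addn0.
have homE : pihomog mdeg d (s * f) = s@_0 *: pihomog mdeg d f.
  have ls : low_coefs_in [set 0] 1 (s - (s@_0)%:MP).
    move=> m; rewrite ltnS leqn0 mdeg_eq0 => /eqP ->.
    by rewrite /= mcoeffB mcoeffC eqxx mulr1 subrr.
  have lsf := low_coefs_inM (@ideal_zero k) ls lf.
  apply/mpolyP => m; rewrite mcoeffZ !mcoeff_pihomog; case: eqP => [md|]; last by rewrite mulr0.
  rewrite -[s in LHS](subrK (s@_0)%:MP) mulrDl mcoeffD lsf ?add0r; last by rewrite md.
  by rewrite mul_mpolyC mcoeffZ.
have Kfd : K (pihomog mdeg d f).
  rewrite -[pihomog _ _ _](scalerK s0) -homE -mul_mpolyC.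
  by apply: ideal_mull => //; apply: hK.
rewrite -(subrK (pihomog mdeg d f) f); apply: ideal_add => //.
apply: (IH d.+1) => [|m|]; last first.
- by rewrite mulrBr; apply: ideal_sub => //; apply: ideal_mull.
- rewrite ltnS leq_eqVlt /= mcoeffB mcoeff_pihomog; case: eqP => [_|_ /= /lf ->].
    by rewrite subrr.
  by rewrite subr0.
rewrite addSnnS (leq_trans (msizeD_le _ _)) // msizeN geq_max fd /=.
rewrite msizeE; apply/bigmax_leqP_seq => m mf _; apply: leq_trans fd.
apply: msize_mdeg_lt; move: mf; rewrite !mcoeff_msupp mcoeff_pihomog.
by case: ifP; rewrite ?eqxx.
Qed.

Lemma initial_degree_low_coefs J x : homogeneous J -> J x ->
  low_coefs_in [set 0] (initial_degree J) x.
Proof.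
move=> hJ Jx m mJ /=; apply: contrapT => /eqP xm.
have H l : (pihomog mdeg (mdeg m) x)@_l != 0 -> mdeg l = mdeg m.
  by rewrite mcoeff_pihomog; have [->|_ /eqP] := eqVneq (mdeg l) (mdeg m).
have nz : pihomog mdeg (mdeg m) x != 0.
  by apply: contra_neq xm => /(congr1 (mcoeff m)); rewrite mcoeff_pihomog eqxx mcoeff0.
have := initial_degree_le (hJ _ Jx (mdeg m)) nz.
rewrite leqNgt => /negP; apply; apply: leq_trans mJ.
by rewrite -(mlead_deg nz) /= ltnS H // mleadc_eq0.
Qed.

Lemma exp_initial_degree J m f : homogeneous J -> ideal_exp J m f -> f != 0 ->
  (m * initial_degree J <= (msize f).-1)%N.
Proof.
move=> hJ Jf f0.
have H : low_coefs_in [set 0] (m * initial_degree J) f.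
  move: f {f0} Jf; elim: m => [//|m IH] _ [r [a [b [Ja Jb ->]]]] l lJ.
  rewrite raddf_sum /= big1 // => i _.
  apply: (low_coefs_inM (@ideal_zero k) _ _ lJ); last exact: (IH _ (Jb i)).
  exact: (initial_degree_low_coefs hJ (Ja i)).
rewrite leqNgt; apply/negP => fm; have : mleadc f != 0 by rewrite mleadc_eq0.
by rewrite H ?eqxx // -ltnS mlead_deg // (mpolySpred _ f0).
Qed.

End Homogeneous.

(** * The case N = 1 *)

Section Principal.
Variables (k : fieldType) (n : nat) (J : set {mpoly k[n]}) (h : {mpoly k[n]}).
Hypotheses (iJ : ideal J) (Jh : J h) (h0 : h != 0).
Hypothesis Jprinc : forall f, J f -> exists g, f = g * h.

Lemma principal_exp m f : ideal_exp J m f -> exists g, f = g * h ^+ m.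
Proof.
move: f; elim: m => [f _|m IH]; first by exists f; rewrite mulr1.
have iT : ideal [set f | exists g, f = g * h ^+ m.+1].
  split=> [|_ _ [g ->] [g' ->]|a _ [g ->]].
  - by exists 0; rewrite mul0r.
  - by exists (g + g'); rewrite mulrDl.
  - by exists (a * g); rewrite mulrA.
apply: (sum_of_products_min iT) => x y /Jprinc[u ->] /IH[v ->].
by exists (u * v); rewrite exprS mulrACA.
Qed.

(** Factors [h] are split off one at a time. If [f = g h^i] with [i < m] and [g] not in [J], take
    [p] in [Ass J] containing [(J : g)]: locally [s f = u h^m] with [s] outside [p], and cancelling
    [h^i] puts [s g] in [J]. *)
Lemma principal_symbolic_power m f : symbolic_power J m f -> exists g, f = g * h ^+ m.
Proof.
move=> Jf; suff H i : (i <= m)%N -> exists g, f = g * h ^+ i by exact: H.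
elim: i => [_|i IH im]; first by exists f; rewrite mulr1.
have [g fE] := IH (ltnW im).
suff /Jprinc[u gE] : J g by exists u; rewrite fE gE -mulrA -exprS.
apply: contrapT => nJg.
have [p [Jp subp]] := exists_Ass (noetherian_mpoly (@noetherian_field k)) iJ nJg.
have [s [ps /principal_exp[u sf]]] := (symbolic_powerE _ _ iJ).1 Jf p Jp.
apply/ps/subp; have -> : s * g = u * h ^+ (m - i.+1) * h.
  apply: (mulIf (expf_neq0 i h0)); rewrite -[LHS]mulrA -fE sf -!mulrA -exprS -exprD.
  by congr (_ * h ^+ _); lia.
exact: ideal_mull.
Qed.

Lemma principal_degree m f : f != 0 -> (exists g, f = g * h ^+ m) ->
  (m * (msize h).-1 <= (msize f).-1)%N.
Proof.
move=> f0 [g fE]; have hm i : (msize (h ^+ i)).-1 = (i * (msize h).-1)%N.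
  elim: i => [|i IH]; first by rewrite expr0 msize1.
  by rewrite exprS deg_mul ?expf_neq0 // IH mulSn.
have g0 : g != 0 by apply: contra_neq f0 => g0; rewrite fE g0 mul0r.
by rewrite fE deg_mul ?expf_neq0 // hm leq_addl.
Qed.

End Principal.

Section TwoVariables.
Variable k : fieldType.
Implicit Types (J : set {mpoly k[2]}) (f g : {mpoly k[2]}).
Let x : {mpoly k[2]} := 'X_ord0.
Let y : {mpoly k[2]} := 'X_ord_max.
Let xdeg (d : nat) : 'X_{1..2} := (U_(ord0) *+ d)%MM.

Let xX d : x ^+ d = 'X_[xdeg d]. Proof. by rewrite /x mpolyXn. Qed.

Let mdeg_xdeg d : mdeg (xdeg d) = d.
Proof. by rewrite /xdeg mdegMn mdeg1 mul1n. Qed.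

Let xdeg0 : xdeg 0 = 0%MM. Proof. by apply/mnmP => i; rewrite /xdeg mulm0n. Qed.

Lemma monomial2P (m : 'X_{1..2}) :
  m = xdeg (mdeg m) \/ exists m', m = (U_(ord_max) + m')%MM.
Proof.
have [m0|m_gt0] := posnP (m ord_max); [left|right].
  apply/mnmP => i; rewrite /xdeg mulmnE mnm1E mdegE big_ord_recl big_ord1 /=.
  have -> : lift ord0 ord0 = ord_max :> 'I_2 by apply/val_inj.
  rewrite m0 addn0; case: (unliftP ord0 i) => [j ->|->]; last by rewrite eqxx mul1n.
  by rewrite ord1; have -> : lift ord0 ord0 = ord_max :> 'I_2 by apply/val_inj.
exists (m - U_(ord_max))%MM; rewrite addmC submK //.
by apply/mnm_lepP => i; rewrite mnm1E; case: eqP => [<-|].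
Qed.

Lemma divisible_y f : (forall d, f@_(xdeg d) = 0) -> exists g, f = y * g.
Proof.
move=> f0; rewrite (mpolyE f).
pose T : set {mpoly k[2]} := [set f | exists g, f = y * g].
have iT : ideal T.
  split=> [|_ _ [g ->] [g' ->]|a _ [g ->]].
  - by exists 0; rewrite mulr0.
  - by exists (g + g'); rewrite mulrDr.
  - by exists (a * g); rewrite mulrCA.
apply: (ideal_sum (J := T)) => // m _; have [->|[m' ->]] := monomial2P m.
  by rewrite f0 scale0r; exact: ideal_0.
by rewrite mpolyXD -mul_mpolyC; apply: (ideal_mull iT); exists 'X_[m'].
Qed.

Lemma mem_ideal_xy (T : set {mpoly k[2]}) f : ideal T -> T x -> T y -> f@_0 = 0 -> T f.
Proof.
move=> iT Tx Ty f0; rewrite (mpolyE f); apply: ideal_sum => // m _.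
rewrite -mul_mpolyC; have [mE|[m' ->]] := monomial2P m.
  rewrite mE -xX; case: (mdeg m) => [|d].
    by rewrite xdeg0 f0 mul0r; exact: ideal_0.
  by rewrite exprSr mulrA; apply: ideal_mull.
by rewrite mpolyXD mulrCA; apply: ideal_mulr.
Qed.

(** The irrelevant ideal; [mem_ideal_xy] shows that [x] and [y] generate it. *)
Let M : set {mpoly k[2]} := [set f | f@_0 = 0].

Lemma constant_part_Ass J f : ideal J -> ~ J f -> J (x * f) -> J (y * f) -> Ass J M.
Proof.
move=> iJ nJf Jx Jy; split.
  apply/prime_idealP; split.
  - split=> [|u v|a u]; rewrite /M /=; first by rewrite mcoeff0.
      by move=> u0 v0; rewrite mcoeffD u0 v0 addr0.
    by move=> u0; rewrite rmorphM /= u0 mulr0.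
  - by rewrite /M /= mcoeff1 eqxx => /eqP; rewrite oner_eq0.
  - by move=> u v /eqP; rewrite rmorphM mulf_eq0 => /orP[] /eqP; [left|right].
exists f; apply/seteqP; split=> r /=.
  exact: (mem_ideal_xy (colon_ideal f iJ)).
move=> Jr; apply: contrapT => /eqP r0; apply: nJf.
have Jr' : J ((r - (r@_0)%:MP) * f).
  apply: (mem_ideal_xy (colon_ideal f iJ)) => //.
  by rewrite mcoeffB mcoeffC eqxx mulr1 subrr.
have : J ((r@_0)%:MP * f).
  by rewrite -[_ * f](subKr (r * f)) -mulrBl; apply: ideal_sub.
move=> /(ideal_mull iJ (r@_0)^-1%:MP).
by rewrite mulrA -mpolyCM mulVf // mul1r.
Qed.

(* [xf, yf \in J] implies [f \in J]: the irrelevant ideal is not associated to [J].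
   A homogeneous [h \in J] with a term [x^a], [a] minimal, then generates [J] up to
   factors [y], since [y] is regular modulo [J]. *)
Lemma homogeneous_principal J f : ideal J -> homogeneous J ->
    (forall f, J (x * f) -> J (y * f) -> J f) -> J f -> f != 0 ->
  exists h, [/\ J h, h != 0 & forall f, J f -> exists g, f = g * h].
Proof.
have xh : x \is 1.-homog by rewrite dhomogX /= mdeg1.
have yh : y \is 1.-homog by rewrite dhomogX /= mdeg1.
have sy : msize y = 2%N by rewrite msizeX mdeg1.
have y0 : y != 0 by rewrite -msize_poly_eq0 sy.
have [b] := ubnP (msize f); elim: b J f => [//|b IH] J f fb iJ hJ socle Jf f0.
(* If [y] divides all of [J], then [J = y (J : y)], and the induction passes to [(J : y)], which
   contains the quotient of [f] by [y]. *)
have [divy|/existsNP[F /not_implyP[JF /existsNP[a0 /eqP Fa0]]]] :=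
    pselect (forall F, J F -> forall d, F@_(xdeg d) = 0).
  have [f1 fE] := divisible_y (divy f Jf).
  have f10 : f1 != 0 by apply: contra_neq f0 => f10; rewrite fE f10 mulr0.
  have [||||||h [Jh h0 hgen]] := IH [set g | J (y * g)] f1.
  - by move: fb; rewrite fE msizeM // sy.
  - have iC := colon_ideal y iJ; suff -> : [set g | J (y * g)] = [set g | J (g * y)] by [].
    by apply/seteqP; split=> g /=; rewrite mulrC.
  - by move=> g /= /hJ Jg d; have := Jg d.+1; rewrite -[d.+1]add1n pihomogMl.
  - move=> g /=; rewrite !(mulrCA y); exact: socle.
  - by rewrite /= -fE.
  - by [].
  exists (y * h); split=> // [|g Jg]; first exact: mulf_neq0.
  have [g1 gE] := divisible_y (divy g Jg).
  by have [|u uE] := hgen g1; [rewrite /= -gE|exists u; rewrite gE uE mulrCA].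
pose Q a := `[< exists2 F, J F & F@_(xdeg a) != 0 >].
have exQ : exists a, Q a by exists a0; apply/asboolP; exists F.
case: (ex_minnP exQ) => a /asboolP[G JG Ga] amin.
pose h := pihomog mdeg a G; pose c := h@_(xdeg a).
have Jh : J h by exact: hJ.
have hh : h \is (a).-homog by exact: pihomogP.
have c0 : c != 0 by rewrite /c /h mcoeff_pihomog mdeg_xdeg eqxx.
have h0 : h != 0 by apply: contra_neq c0 => h0; rewrite /c h0 mcoeff0.
(* Modulo [y], [h] is [c x^a]. So [y g] in [J] gives [x^a g] in [J], and [socle] removes the factors
   [x] one by one. *)
have reg g : J (y * g) -> J g.
  move=> Jyg; have [u uE] : exists u, h - c *: x ^+ a = y * u.
    apply: divisible_y => d; rewrite mcoeffB mcoeffZ xX mcoeffX.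
    have [ad|ad] := eqVneq a d; first by rewrite -ad eqxx mulr1 subrr.
    have /negbTE -> : xdeg a != xdeg d.
      by apply: contra_neq ad => /(congr1 mdeg); rewrite !mdeg_xdeg.
    rewrite mulr0 subr0 (dhomog_nemf_coeff hh) //= mdeg_xdeg.
    by rewrite eq_sym.
  have Jxg : J (x ^+ a * g).
    have -> : x ^+ a * g = c^-1%:MP * (h * g - u * (y * g)).
      have -> : h * g - u * (y * g) = c%:MP * (x ^+ a * g).
        by rewrite mulrCA mulrA -uE mulrBl opprB addrC subrK -scalerAl mul_mpolyC.
      by rewrite [RHS]mulrA -mpolyCM mulVf // mul1r.
    by apply: ideal_mull => //; apply: ideal_sub => //; [apply: ideal_mulr|apply: ideal_mull].
  elim: (a) Jxg => [|d IHd]; first by rewrite mul1r.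
  move=> Jd; apply: IHd; apply: socle; first by rewrite mulrA -exprS.
  by rewrite mulrCA; apply: ideal_mull.
exists h; split=> // g Jg.
(* By minimality of [a], a multiple of [x^(e - a) h] cancels the pure power [x^e] in [q]; [y]
   divides the rest. *)
have top e q : J q -> q \is e.-homog ->
    exists u v, q = u * h + y * v /\ y * v \is e.-homog.
  move=> Jq qh; have [u [uh gx]] : exists u, u * h \is e.-homog /\ (q - u * h)@_(xdeg e) = 0.
    have [gx|gx] := eqVneq (q@_(xdeg e)) 0.
      by exists 0; rewrite mul0r subr0 rpred0.
    have ae : (a <= e)%N by apply: amin; apply/asboolP; exists q.
    exists ((q@_(xdeg e) / c) *: x ^+ (e - a)); split.
      have xe : x ^+ (e - a) \is (e - a).-homog by rewrite xX dhomogX /= mdeg_xdeg.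
      by rewrite -scalerAl rpredZ //; have := dhomogM xe hh; rewrite subnK.
    rewrite mcoeffB -scalerAl mcoeffZ xX [_ * h]mulrC.
    have -> : xdeg e = (xdeg (e - a) + xdeg a)%MM.
      by apply/mnmP => i; rewrite /xdeg mnmDE !mulmnE -mulnDr subnK.
    by rewrite mcoeffMX -/c divfK // subrr.
  have [v vE] : exists v, q - u * h = y * v.
    apply: divisible_y => i; have [->//|ie] := eqVneq i e.
    have gu : q - u * h \is e.-homog by rewrite rpredB.
    by rewrite (dhomog_nemf_coeff gu) //= mdeg_xdeg.
  by exists u, v; rewrite -vE addrC subrK; split=> //; rewrite rpredB.
suff H d g' : J g' -> g' \is d.-homog -> exists u, g' = u * h.
  pose T : set {mpoly k[2]} := [set f | exists g, f = g * h].
  have iT : ideal T.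
    split=> [|_ _ [u ->] [u' ->]|e _ [u ->]].
    - by exists 0; rewrite mul0r.
    - by exists (u + u'); rewrite mulrDl.
    - by exists (e * u); rewrite mulrA.
  rewrite (pihomog_partitionE (leqnn (msize g))).
  apply: (ideal_sum (J := T)) => // i _; apply: (H i); first exact: hJ.
  exact: pihomogP.
elim: d g' => [|d IHd] q Jq qh; have [u [v [qE yv]]] := top _ _ Jq qh.
  exists u; rewrite qE -[y * v](pihomog_dE yv).
  by rewrite (pihomogMl_lt _ yh) // addr0.
(* [v] need not be homogeneous, but [y * v] is, so [v] may be replaced by its component of degree
   [d]. *)
have Jv : J (pihomog mdeg d v).
  apply: hJ; apply: reg; rewrite -[y * v](addKr (u * h)) -qE.
  by apply: ideal_add => //; apply: ideal_opp => //; apply: ideal_mull.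
have [w wE] := IHd _ Jv (pihomogP _ _ _).
exists (u + y * w); rewrite qE -[y * v](pihomog_dE yv) -[d.+1]add1n.
by rewrite (pihomogMl _ _ yh) wE mulrDl mulrA.
Qed.

Lemma loc_constant_part J m f : ideal J -> homogeneous J -> Ass J M ->
  symbolic_power J m f -> ideal_exp J m f.
Proof.
move=> iJ hJ JM /(symbolic_powerE _ _ iJ)/(_ M JM)[s [/eqP s0]].
by apply: homogeneous_cancel => //; [exact: exp_ideal|exact: exp_homogeneous].
Qed.

Definition principal J := exists h, [/\ J h, h != 0 & forall f, J f -> exists g, f = g * h].

Lemma Ass_constant_part_or_principal J f : ideal J -> homogeneous J -> J f -> f != 0 ->
  Ass J M \/ principal J.
Proof.
move=> iJ hJ Jf f0.
have [socle|/existsNP[g]] := pselect (forall g, J (x * g) -> J (y * g) -> J g).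
  by right; apply: homogeneous_principal Jf f0.
by move=> /not_implyP[Jx /not_implyP[Jy nJg]]; left; apply: constant_part_Ass nJg Jx Jy.
Qed.

(** The degree bound is applied to [I^(t)], and either alternative suffices there. If the irrelevant
    ideal is associated to [J], then [J^(t) = J^t]; otherwise [J] has a generator [h], and [h^t]
    generates [J^(t)]. *)
Lemma symbolic_power_homogeneous_or_principal J t f : ideal J -> homogeneous J ->
    J f -> f != 0 ->
  homogeneous (symbolic_power J t) \/ principal (symbolic_power J t).
Proof.
move=> iJ hJ Jf f0; have [JM|[h [Jh h0 hgen]]] := Ass_constant_part_or_principal iJ hJ Jf f0.
  left=> g /(loc_constant_part iJ hJ JM) Jg d; apply: sub_symbolic_power => //.
  exact: exp_homogeneous.
right; exists (h ^+ t); split; last exact: principal_symbolic_power.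
- by apply: sub_symbolic_power => //; apply: expX.
- exact: expf_neq0.
Qed.

Lemma symbolic_power_initial_degree2 J m f : ideal J -> J f -> f != 0 ->
    homogeneous J \/ principal J ->
  (m * initial_degree J <= initial_degree (symbolic_power J m))%N.
Proof.
move=> iJ Jf f0 homprinc.
have Jfm : symbolic_power J m (f ^+ m) by apply: sub_symbolic_power => //; apply: expX.
have [g [Jg g0 <-]] := initial_degree_attained Jfm (expf_neq0 m f0).
have [[h [Jh h0 hgen]]|[hJ JM]] : principal J \/ homogeneous J /\ Ass J M.
  case: homprinc => [hJ|]; last by left.
  by have [JM|] := Ass_constant_part_or_principal iJ hJ Jf f0; [right|left].
- apply: leq_trans (principal_degree h0 g0 (principal_symbolic_power iJ Jh h0 hgen Jg)).
  by rewrite leq_mul2l (initial_degree_le Jh h0) orbT.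
- exact: exp_initial_degree hJ (loc_constant_part iJ hJ JM Jg) g0.
Qed.

End TwoVariables.

Theorem theorem3p7 (k : fieldType) (N : nat) (hN : (0 < N)%N)
  (I : set {mpoly k[N.+1]})
  (I_ideal : idealr_closed [pred f in I]) (I_homog : homogeneous I) (I_neq0 : I <> [set 0]) :
  exists2 t0 : nat, (0 < t0)%N &
    forall t : nat, (t0 <= t)%N -> forall m : nat, (0 < m)%N ->
      ((initial_degree (symbolic_power I t))%:R + N%:R - 1) / N%:R
        <= (initial_degree (symbolic_power (symbolic_power I t) m))%:R / m%:R
        :> rat.
Proof.
have [iI I1] := idealr_closed_ideal I_ideal.
have [g Ig g0] : exists2 g, I g & g != 0.
  apply: contrapT => nex; apply: I_neq0; apply/seteqP; split=> [f If|_ ->].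
    by apply: contrapT => /eqP f0; apply: nex; exists f.
  exact: ideal_0.
(* Denominators are cleared; [N > 0] keeps the truncated subtraction exact. *)
suff [t0 Ht0] : exists t0, forall t, (t0 < t)%N -> forall m,
    (m * (initial_degree (symbolic_power I t) + N - 1) <=
     N * initial_degree (symbolic_power (symbolic_power I t) m))%N.
  exists t0.+1 => // t tt0 m m0.
  rewrite ler_pdivrMr ?ltr0n // mulrAC ler_pdivlMr ?ltr0n //.
  rewrite -natrD -[1]/(1%:R) -natrB ?addn_gt0 ?hN ?orbT // -!natrM ler_nat.
  by rewrite mulnC [X in (_ <= X)%N]mulnC; exact: Ht0.
have [N1|] := ltnP 1 N; first exact: symbolic_power_bound N1 iI I1 Ig g0.
case: N hN I {I_ideal I_neq0} I_homog g iI I1 Ig g0 => [//|[|//]] _ I hI g iI I1 Ig g0 _.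
exists 0%N => t _ m; rewrite addnK mul1n.
apply: (@symbolic_power_initial_degree2 _ _ m (g ^+ t)).
- exact: symbolic_power_ideal.
- by apply: sub_symbolic_power => //; apply: expX.
- exact: expf_neq0.
- exact: symbolic_power_homogeneous_or_principal Ig g0.
Qed.
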